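(* Let $A\in\mathbb{C}^{n\times n}$, let $k\ge 1$, let $\lambda_0\in\sigma(A)$ have algebraic multiplicity $2k$ and geometric multiplicity $1$, and let $\{u_i\}_{i=1}^{2k}$ and $\{v_i\}_{i=1}^{2k}$ be left and right Jordan chains of $A$ for $\lambda_0$. Define the $n\times k$ matrices $$U:=\begin{bmatrix}u_1&u_2&\cdots&u_k\end{bmatrix},\qquad V:=\begin{bmatrix}v_1&v_2&\cdots&v_k\end{bmatrix}.$$ Let $R,L\in\mathbb{C}^{n\times k}$ be matrices satisfying $U^*L=R^*V=I_k$. Then for any $\lambda_1\in\mathbb{C}$ the matrix $$\widehat{A}:=A+(\lambda_1-\lambda_0)R_1R_2^*,\qquad R_1:=\begin{bmatrix}V&L\end{bmatrix},\quad R_2:=\begin{bmatrix}R&U\end{bmatrix},$$ has the following properties: (a) The eigenvalues of $\widehat{A}$ (counted with algebraic multiplicity) consist of those of $A$, except that the eigenvalue $\lambda_0$ of $A$ (with its $2k$ copies) is replaced by $\lambda_1$. (b) $\widehat{A}v_1=\lambda_1v_1$, $u_1^*\widehat{A}=\lambda_1u_1^*$, and $\widehat{A}v_{i+1}=\lambda_1v_{i+1}+v_i$, $u_{i+1}^*\widehat{A}=\lambda_1u_{i+1}^*+u_i^*$ for $i=1,\ldots,k-1$. That is, $\widehat{A}V=VJ_k(\lambda_1)$ and $U^*\widehat{A}=J_k^\top(\lambda_1)U^*$.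
   Context: $\sigma(A)$ is the set of eigenvalues of $A$, and $^*$ denotes conjugate transpose. $J_k(\lambda)$ is the $k\times k$ Jordan block with $\lambda$ on the diagonal and $1$ on the superdiagonal. A right Jordan chain $\{v_i\}_{i=1}^{m}$ of $A$ for $\lambda_0$ satisfies $v_1\neq0$, $Av_1=\lambda_0v_1$ and $Av_{i+1}=\lambda_0v_{i+1}+v_i$ for $1\le i<m$. A left Jordan chain $\{u_i\}_{i=1}^{m}$ satisfies $u_1\ne0$, $u_1^*A=\lambda_0u_1^*$ and $u_{i+1}^*A=\lambda_0u_{i+1}^*+u_i^*$ for $1\le i<m$. *)

(* Defs.v *)
From mathcomp Require Import all_boot all_order all_algebra.
From mathcomp Require Import reals complex.

Set Implicit Arguments.
Unset Strict Implicit.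
Unset Printing Implicit Defensive.

Import Order.TTheory GRing.Theory Num.Theory.

Local Open Scope ring_scope.
Local Open Scope sesquilinear_scope.

Section Spectrum.
Variables (C : numClosedFieldType) (n : nat).
Implicit Types (A : 'M[C]_n) (a : C).

(* [eigenvalue] and [eigenspace] are about row vectors x with x *m A = a *: x;
   transposing A turns them into the usual notions for column vectors. *)
Definition spectrum A : pred C := eigenvalue A^T.

Definition geom_mult a A : nat := \rank (eigenspace A^T a).

Definition alg_mult a A : nat := mup a (char_poly A).

(* The roots of char_poly A, repeated according to their multiplicity, in an
   unspecified order: compare such lists with [perm_eq] only. *)
Definition eigenvalues A : seq C :=
  sval (closed_field_poly_normal (char_poly A)).

Lemma eigenvaluesE A :
  char_poly A = \prod_(a <- eigenvalues A) ('X - a%:P).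
Proof.
rewrite /eigenvalues; case: closed_field_poly_normal => s /= {1}->.
by rewrite (monicP (char_poly_monic A)) scale1r.
Qed.

Lemma alg_multE a A : alg_mult a A = count_mem a (eigenvalues A).
Proof. by rewrite /alg_mult eigenvaluesE mu_prod_XsubC. Qed.

End Spectrum.

Section JordanChains.
Variables (C : numClosedFieldType) (n : nat).
Implicit Types (A : 'M[C]_n) (a : C) (m : nat).

(* A chain of length m is a sequence indexed from 1: only the entries 1, ..., m
   are relevant. *)
Definition right_Jordan_chain A a m (v : nat -> 'cV[C]_n) : Prop :=
  [/\ v 1%N != 0,
      A *m v 1%N = a *: v 1%N
    & forall i : nat, (1 <= i < m)%N -> A *m v i.+1 = a *: v i.+1 + v i].

Definition left_Jordan_chain A a m (u : nat -> 'cV[C]_n) : Prop :=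
  [/\ u 1%N != 0,
      (u 1%N) ^t* *m A = a *: (u 1%N) ^t*
    & forall i : nat, (1 <= i < m)%N ->
        (u i.+1) ^t* *m A = a *: (u i.+1) ^t* + (u i) ^t*].

(* The matrix with columns w 1, ..., w k. *)
Definition chain_mx k (w : nat -> 'cV[C]_n) : 'M[C]_(n, k) :=
  \matrix_(i < n, j < k) w j.+1 i 0.

End JordanChains.

Definition Jordan_block (C : numClosedFieldType) (k : nat) (a : C) : 'M[C]_k :=
  \matrix_(i < k, j < k) (a *+ (i == j) + (j == i.+1 :> nat)%:R).

(* Main.v *)
(* For i + j <= 2 k the products u_i^* v_j vanish: (A - lambda0) shifts both
   chains, so u_i^* v_j = u_1^* v_(i+j-1), which is 0 since v_(i+j-1) is in the
   range of A - lambda0. Hence U^* V = 0, which yields (b) at once.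
   For (a), Ahat is obtained from A by two Rado updates, A + d V R^* and then
   + d L U^*. If A V = V J then
     char_poly (A + V C) * char_poly J = char_poly A * char_poly (J + C V),
   so each update trades k copies of the root lambda0 for k copies of lambda1;
   U^* V = 0 makes U^* still span an invariant space after the first update. *)
Require Import Defs.
From mathcomp Require Import all_boot all_order all_algebra.
From mathcomp Require Import reals complex.

Set Implicit Arguments.
Unset Strict Implicit.
Unset Printing Implicit Defensive.

Import Order.TTheory GRing.Theory Num.Theory.

Local Open Scope ring_scope.
Local Open Scope sesquilinear_scope.

(** Both sides compute the determinant of [block_mx P V C 1%:M] times [\det Q]: a Schur complement
    gives the left one, and clearing the block [V] by means of [P *m V = V *m Q] gives the right
    one. *)
Lemma det_sub_mul_intertwine (S : comPzRingType) n k (P : 'M[S]_n) (Q : 'M_k)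
    (V : 'M_(n, k)) (C : 'M_(k, n)) :
  P *m V = V *m Q ->
  \det (P - V *m C) * \det Q = \det P * \det (Q - C *m V).
Proof.
move=> PV.
have defl : block_mx P V C 1%:M =
    block_mx (P - V *m C) V 0 1%:M *m block_mx 1%:M 0 C 1%:M.
  by rewrite mulmx_block !mulmx1 !mul1mx !mulmx0 !add0r subrK.
have defr : block_mx P V C 1%:M *m block_mx 1%:M (- V) 0 Q =
    block_mx P 0 C (Q - C *m V).
  by rewrite mulmx_block !mulmx1 !mul1mx !mulmx0 !addr0 !mulmxN PV addNr addrC.
rewrite -(det_lblock P C) -defr defl !det_mulmx !det_ublock det_lblock.
by rewrite !det1 !mulr1 mul1r.
Qed.

Section CharPoly.
Variable F : comNzRingType.

(** The scalar matrix ['X] commutes with [V], so ['X - A] and ['X - J] are intertwined by [V] over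
    the polynomials. *)
Lemma char_poly_Rado n k (A : 'M[F]_n) (J : 'M_k) (V : 'M_(n, k))
    (C : 'M_(k, n)) :
  A *m V = V *m J ->
  char_poly (A + V *m C) * char_poly J = char_poly A * char_poly (J + C *m V).
Proof.
move=> AV; rewrite /char_poly /char_poly_mx !map_mxD !map_mxM !opprD !addrA.
apply: det_sub_mul_intertwine.
by rewrite mulmxBl mulmxBr -!map_mxM AV scalar_mxC.
Qed.

Lemma char_poly_tr n (A : 'M[F]_n) : char_poly A^T = char_poly A.
Proof.
rewrite /char_poly -det_tr /char_poly_mx linearB /= tr_scalar_mx map_trmx.
by rewrite trmxK.
Qed.

End CharPoly.

Section JordanUpdate.
Variable C : numClosedFieldType.

Lemma char_poly_Jordan_block k (a : C) :
  char_poly (Jordan_block k a) = ('X - a%:P) ^+ k.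
Proof.
(* [is_trig_mx] means lower triangular, hence the transposition. *)
rewrite -char_poly_tr char_poly_trig; last first.
  apply/is_trig_mxP => i j ltij; rewrite !mxE.
  by rewrite -val_eqE /= gtn_eqF // ltn_eqF ?addr0 // ltnS ltnW.
rewrite (eq_bigr (fun=> 'X - a%:P)) ?prodr_const ?card_ord // => i _.
by rewrite !mxE eqxx ltn_eqF // addr0.
Qed.

Lemma Jordan_blockD k (a b : C) :
  Jordan_block k (a + b) = Jordan_block k a + b%:M.
Proof. by apply/matrixP=> i j; rewrite !mxE mulrnDl addrAC. Qed.

Lemma char_poly_Jordan_updater n k (A : 'M[C]_n) (V : 'M_(n, k))
    (W : 'M_(k, n)) (a d : C) :
  A *m V = V *m Jordan_block k a -> W *m V = 1%:M ->
  char_poly (A + d *: (V *m W)) * ('X - a%:P) ^+ k =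
  char_poly A * ('X - (a + d)%:P) ^+ k.
Proof.
move=> AV WV; rewrite -!char_poly_Jordan_block Jordan_blockD scalemxAr.
by rewrite (char_poly_Rado _ AV) -scalemxAl WV scalemx1.
Qed.

(** Transposing exchanges the roles of [V] and [W] and reduces to the previous case. *)
Lemma char_poly_Jordan_updatel n k (A : 'M[C]_n) (V : 'M_(n, k))
    (W : 'M_(k, n)) (a d : C) :
  W *m A = (Jordan_block k a)^T *m W -> W *m V = 1%:M ->
  char_poly (A + d *: (V *m W)) * ('X - a%:P) ^+ k =
  char_poly A * ('X - (a + d)%:P) ^+ k.
Proof.
move=> WA WV; rewrite -char_poly_tr linearD linearZ /= trmx_mul.
rewrite -(char_poly_tr A); apply: char_poly_Jordan_updater.
  by rewrite -trmx_mul WA trmx_mul trmxK.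
by rewrite -trmx_mul WV trmx1.
Qed.

(** Each side of the hypothesis is a product of linear factors over a padded list, and the
    multiplicities of its roots count the entries of that list. *)
Lemma perm_eigenvalues_exchange n (A B : 'M[C]_n) (a b : C) m :
  char_poly B * ('X - a%:P) ^+ m = char_poly A * ('X - b%:P) ^+ m ->
  perm_eq (eigenvalues B ++ nseq m a) (eigenvalues A ++ nseq m b).
Proof.
have prodE (M : 'M[C]_n) c : char_poly M * ('X - c%:P) ^+ m =
    \prod_(x <- eigenvalues M ++ nseq m c) ('X - x%:P).
  by rewrite big_cat /= -eigenvaluesE big_nseq iter_mulr_1.
rewrite !prodE => eqAB; apply/allP=> c _.
by rewrite /= -!mu_prod_XsubC eqAB.
Qed.

Lemma mul_conj_tr p q r (M : 'M[C]_(p, q)) (N : 'M_(q, r)) :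
  (M *m N) ^t* = N ^t* *m M ^t*.
Proof. by rewrite trmx_mul map_mxM. Qed.

Lemma tr_conj_Jordan_block k (a : C) :
  (Jordan_block k a^* ) ^t* = (Jordan_block k a)^T.
Proof.
by apply/matrixP=> i j; rewrite !mxE rmorphD /= conjC_nat rmorphMn /= conjCK.
Qed.

Section Chains.
Variables (n m : nat).
Implicit Types (A : 'M[C]_n) (a : C) (u v w : nat -> 'cV[C]_n).

Lemma col_chain_mx k w (j : 'I_k) : col j (chain_mx k w) = w j.+1.
Proof. by apply/colP=> i; rewrite !mxE. Qed.

(** Lets the matrix form of a left chain follow from that of a right chain. *)
Lemma left_Jordan_chain_adjoint A a u :
  left_Jordan_chain A a m u -> right_Jordan_chain (A ^t* ) a^* m u.
Proof.
move=> [u1 uA uAS]; split=> // [|i /uAS uAi].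
  by rewrite -{1}(trmxCK (u 1%N)) -mul_conj_tr uA linearZ /= map_mxZ trmxCK.
rewrite -{1}(trmxCK (u i.+1)) -mul_conj_tr uAi linearD linearZ /=.
by rewrite map_mxD map_mxZ !trmxCK.
Qed.

Lemma mul_chain_mx_Jordan A a v k : (k <= m)%N -> right_Jordan_chain A a m v ->
  A *m chain_mx k v = chain_mx k v *m Jordan_block k a.
Proof.
move=> lekm [_ Av1 AvS]; apply/matrixP => i j.
transitivity (col j (A *m chain_mx k v) i 0); first by rewrite [RHS]mxE.
rewrite colE -mulmxA -colE col_chain_mx.
(* The sum splits into a diagonal and a superdiagonal part; the latter vanishes in column [0] and
   leaves only the term [l = j] in column [j.+1]. *)
rewrite [RHS]mxE; under eq_bigr do rewrite !mxE mulrDr; rewrite big_split /=.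
rewrite (bigD1 j) //= eqxx big1 ?addr0 => [|l /negPf->]; last by rewrite mulr0.
case: j => -[|j] ltjk /=.
  by rewrite Av1 mxE big1 ?addr0 1?mulrC // => l _; rewrite mulr0.
rewrite AvS ?(leq_trans ltjk) // !mxE mulrC; congr (_ + _).
rewrite (bigD1 (Ordinal (ltnW ltjk))) //= eqxx mulr1 big1 ?addr0 // => l.
by rewrite -val_eqE eqSS eq_sym => /negPf/= ->; rewrite mulr0.
Qed.

Lemma chain_mx_mul_Jordan A a u k : (k <= m)%N -> left_Jordan_chain A a m u ->
  (chain_mx k u) ^t* *m A = (Jordan_block k a)^T *m (chain_mx k u) ^t*.
Proof.
move=> lekm Lu.
have eqU := mul_chain_mx_Jordan lekm (left_Jordan_chain_adjoint Lu).
by rewrite -tr_conj_Jordan_block -mul_conj_tr -eqU mul_conj_tr trmxCK.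
Qed.

Lemma Jordan_chains_orthogonal A a u v i j :
  left_Jordan_chain A a m u -> right_Jordan_chain A a m v ->
  (0 < i)%N -> (0 < j)%N -> (i + j <= m)%N -> (u i) ^t* *m v j = 0.
Proof.
move=> [_ uA uAS] [_ Av AvS].
elim: i j => // i IHi j _ j_gt0 leijm.
(* The index [j.+1] is still in the chain, because the index of [u] is at least 1. *)
have vj : v j = A *m v j.+1 - a *: v j.+1.
  rewrite AvS 1?addrC ?addKr // j_gt0 (leq_trans _ leijm) //.
  by rewrite addSn ltnS leq_addl.
rewrite vj mulmxBr mulmxA -scalemxAr.
(* For [u 1] the two terms cancel; otherwise [A - a] lowers the index of [u] by one while that of
   [v] has risen by one, so the sum of the indices is kept. *)
case: i IHi leijm => [_ _|i IHi leijm]; first by rewrite uA -scalemxAl subrr.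
rewrite uAS ?mulmxDl -?scalemxAl; last first.
  by rewrite (leq_trans _ leijm) ?leq_addr.
by rewrite addrAC subrr add0r IHi // addnS -addSn.
Qed.

Lemma chain_mx_orthogonal A a u v k : (2 * k <= m)%N ->
  left_Jordan_chain A a m u -> right_Jordan_chain A a m v ->
  (chain_mx k u) ^t* *m chain_mx k v = 0.
Proof.
move=> le2km Lu Rv; apply/matrixP => i j.
have := Jordan_chains_orthogonal Lu Rv (ltn0Sn i) (ltn0Sn j).
rewrite (leq_trans _ le2km) ?mul2n -?addnn ?leq_add // => /(_ isT)/matrixP.
move=> /(_ 0 0); rewrite !mxE => uv0; rewrite -[RHS]uv0.
by apply: eq_bigr => l _; rewrite !mxE.
Qed.

End Chains.
End JordanUpdate.

Theorem theorem3p1 (K : realType) (n k : nat) (A : 'M[K[i]]_n)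
    (lambda0 : K[i]) (u v : nat -> 'cV[K[i]]_n) (R L : 'M[K[i]]_(n, k)) :
  (1 <= k)%N ->
  lambda0 \in spectrum A ->
  alg_mult lambda0 A = (2 * k)%N ->
  geom_mult lambda0 A = 1%N ->
  left_Jordan_chain A lambda0 (2 * k) u ->
  right_Jordan_chain A lambda0 (2 * k) v ->
  let U := chain_mx k u in
  let V := chain_mx k v in
  U ^t* *m L = 1%:M ->
  R ^t* *m V = 1%:M ->
  forall lambda1 : K[i],
  let R1 := row_mx V L in
  let R2 := row_mx R U in
  let Ahat := A + (lambda1 - lambda0) *: (R1 *m R2 ^t*) in
  (* (a) *)
  perm_eq (eigenvalues Ahat)
    (nseq (2 * k) lambda1 ++ [seq a <- eigenvalues A | a != lambda0])
  /\
  (* (b) *)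
  [/\ Ahat *m v 1%N = lambda1 *: v 1%N,
      (u 1%N) ^t* *m Ahat = lambda1 *: (u 1%N) ^t*,
      forall i : nat, (1 <= i <= k.-1)%N ->
        Ahat *m v i.+1 = lambda1 *: v i.+1 + v i
        /\ (u i.+1) ^t* *m Ahat = lambda1 *: (u i.+1) ^t* + (u i) ^t*,
      Ahat *m V = V *m Jordan_block k lambda1
    & U ^t* *m Ahat = (Jordan_block k lambda1)^T *m U ^t*].
Proof.
move=> k_gt0 _ mult_lam _ Lu Rv U V UL RV lambda1 R1 R2 Ahat.
pose d := lambda1 - lambda0.
have lekm : (k <= 2 * k)%N by rewrite leq_pmull.
have AV : A *m V = V *m Jordan_block k lambda0 := mul_chain_mx_Jordan lekm Rv.
have UA : U ^t* *m A = (Jordan_block k lambda0)^T *m U ^t* :=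
  chain_mx_mul_Jordan lekm Lu.
have UV : U ^t* *m V = 0 := chain_mx_orthogonal (leqnn _) Lu Rv.
have lamE : lambda0 + d = lambda1 by rewrite addrC subrK.
have JE : Jordan_block k lambda1 = Jordan_block k lambda0 + d%:M.
  by rewrite -Jordan_blockD lamE.
have R12 : R1 *m R2 ^t* = V *m R ^t* + L *m U ^t*.
  by rewrite tr_row_mx map_col_mx mul_row_col.
(* [R1 *m R2 ^t*] fixes the columns of [V] and the rows of [U ^t*], so on them [Ahat] acts as
   [A + d]. *)
have PV : R1 *m R2 ^t* *m V = V.
  by rewrite R12 mulmxDl -!mulmxA RV UV mulmx1 mulmx0 addr0.
have UP : U ^t* *m (R1 *m R2 ^t*) = U ^t*.
  by rewrite R12 mulmxDr !mulmxA UV UL mul0mx mul1mx add0r.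
have Pv i : (i < k)%N -> Ahat *m v i.+1 = A *m v i.+1 + d *: v i.+1.
  move=> ltik; rewrite mulmxDl -scalemxAl; congr (_ + _ *: _).
  by rewrite -(col_chain_mx v (Ordinal ltik)) colE mulmxA PV.
have uP i : (i < k)%N ->
    (u i.+1) ^t* *m Ahat = (u i.+1) ^t* *m A + d *: (u i.+1) ^t*.
  move=> ltik; rewrite mulmxDr -scalemxAr; congr (_ + _ *: _).
  by rewrite -(col_chain_mx u (Ordinal ltik)) tr_col map_row -row_mul UP.
split; last first.
  case: (Lu) (Rv) => [_ uA uAS] [_ Av AvS]; split.
  - by rewrite Pv // Av -scalerDl lamE.
  - by rewrite uP // uA -scalerDl lamE.
  - move=> i /andP[i_gt0 leik1].
    have ltik : (i < k)%N by rewrite -(prednK k_gt0) ltnS.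
    have i_bounds : (1 <= i < 2 * k)%N by rewrite i_gt0 (leq_trans ltik).
    by rewrite Pv // uP // AvS // uAS // !(addrAC _ _ (d *: _)) -!scalerDl lamE.
  - rewrite mulmxDl -scalemxAl PV AV JE mulmxDr.
    by rewrite mul_mx_scalar.
  - rewrite mulmxDr -scalemxAr UP UA JE linearD /= mulmxDl.
    by rewrite tr_scalar_mx mul_scalar_mx.
have UA1 : U ^t* *m (A + d *: (V *m R ^t*)) =
    (Jordan_block k lambda0)^T *m U ^t*.
  by rewrite mulmxDr -scalemxAr mulmxA UV mul0mx scaler0 addr0.
have charE : char_poly Ahat * ('X - lambda0%:P) ^+ (2 * k) =
    char_poly A * ('X - lambda1%:P) ^+ (2 * k).
  (* The update by [L *m U ^t*] is undone first and that by [V *m R ^t*] next, each using [k] of the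
     [2 * k] factors. *)
  rewrite mul2n -addnn !exprD !mulrA -/d /Ahat R12 scalerDr addrA.
  rewrite (char_poly_Jordan_updatel _ UA1 UL) mulrAC.
  by rewrite (char_poly_Jordan_updater _ AV RV) lamE.
(* The algebraic multiplicity enters here: [2 * k] copies are all the occurrences of [lambda0]. *)
have eig0 : [seq a <- eigenvalues A | a == lambda0] = nseq (2 * k) lambda0.
  rewrite -mult_lam alg_multE -size_filter; apply/all_pred1P.
  exact: filter_all.
(* Padding with the removed copies of [lambda0] completes the filtered list to [eigenvalues A]. *)
rewrite -(perm_cat2r (nseq (2 * k) lambda0)).
apply: perm_trans (perm_eigenvalues_exchange charE) _.
by rewrite -catA perm_catC perm_cat2l perm_sym perm_catC -eig0 perm_filterC.
Qed.
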